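(* Let $M$ be a manifold, $G$ a Lie group, and $\rho\colon G\to\mathrm{Diff}(M)$ an effective smooth action. Suppose that there exist a natural number $k$ and a point $\mu=(m_1,\ldots,m_k)\in M^k$ such that the orbit map $G\to M^k$, $g\mapsto(\rho(g)(m_1),\ldots,\rho(g)(m_k))$, for the diagonal action of $G$ on $M^k$, is an embedding. Then $\rho\colon G\to\mathrm{Diff}(M)$ is an embedding, where $\mathrm{Diff}(M)$ carries the functional diffeology.
   Context: All manifolds, and in particular all Lie groups, are smooth, Hausdorff, second countable and finite dimensional. A parametrization on a set $X$ is a map from an open subset of $\mathbf{R}^n$, for some $n\in\mathbf{N}$, to $X$. A diffeology on $X$ is a set of parametrizations, called plots, such that: constant parametrizations are plots; being a plot is a local condition (if every point of the domain of a parametrization has an open neighbourhood on which the restriction is a plot, then the parametrization is a plot); and precomposing a plot with a map that is smooth in the usual sense, between open subsets of Euclidean spaces, gives a plot. A diffeological space is a set with a diffeology. A map between diffeological spaces is smooth if its composition with every plot of the source is a plot of the target; a diffeomorphism is a smooth bijection with smooth inverse. A manifold is given the diffeology whose plots are the parametrizations that are smooth in the usual sense. The functional diffeology on the group $\mathrm{Diff}(M)$ of diffeomorphisms of $M$ has as plots the parametrizations $U\to\mathrm{Diff}(M)$, $r\mapsto f_r$, for which $(r,m)\mapsto f_r(m)$, $U\times M\to M$, is smooth. A smooth action of a Lie group $G$ on $M$ is a group homomorphism $\rho\colon G\to\mathrm{Diff}(M)$ that is smooth for the functional diffeology; equivalently, $(g,m)\mapsto\rho(g)(m)$ is a smooth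 map $G\times M\to M$. It is effective if $\rho$ is injective. The subset diffeology on a subset $A$ of a diffeological space $X$ consists of the plots of $X$ with values in $A$. An induction is an injective smooth map that is a diffeomorphism onto its image, where the image carries the subset diffeology. The D-topology of a diffeological space $X$ is the topology in which a subset of $X$ is open if and only if its preimage under every plot is open; on a manifold it is the usual topology. An embedding is an induction that is also a homeomorphism onto its image, when the source carries its D-topology and the image carries the subset topology induced from the D-topology of the target. *)

(* Defs.v *)
From HB Require Import structures.
From mathcomp Require Import all_boot all_order all_algebra.
From mathcomp Require Import all_classical all_reals all_analysis.

Set Implicit Arguments.
Unset Strict Implicit.
Unset Printing Implicit Defensive.

Import Order.TTheory GRing.Theory Num.Theory.
Import numFieldNormedType.Exports.

Local Open Scope classical_set_scope.
Local Open Scope ring_scope.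

Section EuclideanSmoothness.
Context {R : realType}.

(* f is C^k on U, for U open: C^0 is continuity, and C^(k+1) is (Frechet)
   differentiability with all directional derivatives C^k. *)
Fixpoint Ck {m : nat} {W : normedModType R} (k : nat)
    (U : set 'rV[R]_m) (f : 'rV[R]_m -> W) : Prop :=
  if k is k'.+1 then
    (forall x, U x -> differentiable f x) /\ (forall v, Ck k' U ('D_v f))
  else forall x, U x -> {for x, continuous f}.

Definition Cinfty {m : nat} {W : normedModType R}
    (U : set 'rV[R]_m) (f : 'rV[R]_m -> W) : Prop :=
  forall k, Ck k U f.

Lemma near_eq_differentiable (V W : normedModType R) (f g : V -> W) (x : V) :
  (\near x, f x = g x) -> differentiable f x -> differentiable g x.
Proof.
move=> fg df.
have gE : g = f + (g - f) by rewrite addrC subrK.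
rewrite gE; apply: differentiableD => //.
have h0 : \near x, (g - f) x = 0.
  by apply: filterS fg => y; rewrite !fctE => ->; rewrite subrr.
have hx : (g - f) x = 0 by exact: nbhs_singleton h0.
apply/diff_locallyP.
have key : continuous (\0 : V -> W) /\
    ((g - f) \o shift x = cst ((g - f) x) + (\0 : V -> W) +o_ (0:V) id).
  split; first by move=> y; exact: cvg_cst.
  apply/eqaddoP => e e0.
  have h0' := h0; rewrite (near_shift 0 x) in h0'.
  apply: filterS h0' => y /=; rewrite subr0 !fctE => ->.
  have -> : g x - f x = 0 := hx.
  by rewrite addr0 subr0 normr0 mulr_ge0 // ltW.
have [c e] := key.
have -> : 'd (g - f) x = \0 :> (V -> W).
  by apply: (@diff_unique _ _ _ _ \0).
by [].
Qed.

Section Ck_theory.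
Context {m : nat}.
Implicit Types U V : set 'rV[R]_m.

Lemma CkW {W : normedModType R} k U (f : 'rV[R]_m -> W) :
  Ck k.+1 U f -> Ck k U f.
Proof.
elim: k f => [|k IH] f [df Df].
  by move=> x Ux; apply/differentiable_continuous/df.
by split=> // v; apply: IH; exact: Df.
Qed.

Lemma Ck_sub {W : normedModType R} k U V (f : 'rV[R]_m -> W) :
  V `<=` U -> Ck k U f -> Ck k V f.
Proof.
move=> VU; elim: k f => [|k IH] f /=; first by move=> cf x /VU; exact: cf.
by move=> [df Df]; split=> [x /VU|v]; [exact: df|exact: IH].
Qed.

Lemma Ck_local {W : normedModType R} k U (f : 'rV[R]_m -> W) :
  (forall x, U x -> exists2 V, V x & Ck k V f) -> Ck k U f.
Proof.
elim: k f => [|k IH] f loc /=.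
  by move=> x /loc[V Vx]; apply.
split=> [x /loc[V Vx [df _]]|v]; first exact: df.
by apply: IH => x /loc[V Vx [_ Df]]; exists V => //; exact: Df.
Qed.

Lemma Ck_eq {W : normedModType R} k U (f g : 'rV[R]_m -> W) :
  open U -> (forall x, U x -> f x = g x) -> Ck k U f -> Ck k U g.
Proof.
move=> oU; elim: k f g => [|k IH] f g fg.
  move=> cf x Ux; have fgx : \near x, f x = g x.
    by apply: filterS (open_nbhs_nbhs (conj oU Ux)) => y; exact: fg.
  rewrite /prop_for /continuous_at -(fg _ Ux).
  by apply: cvg_trans (cf x Ux); apply: near_eq_cvg fgx; exact: nbhs_filter.
move=> [df Df]; split=> [x Ux|v].
  apply: (near_eq_differentiable _ (df x Ux)).
  by apply: filterS (open_nbhs_nbhs (conj oU Ux)) => y; exact: fg.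
apply: IH (Df v) => x Ux; apply: near_eq_derive.
by apply: filterS (open_nbhs_nbhs (conj oU Ux)) => y; exact: fg.
Qed.

Lemma Ck_cst {W : normedModType R} k U (w : W) : Ck k U (cst w).
Proof.
elim: k w => [|k IH] w; first by move=> x _; exact: cst_continuous.
split=> [x _|v]; first exact: differentiable_cst.
have -> : 'D_v (cst w) = cst 0 :> ('rV[R]_m -> W).
  by apply/funext => x; rewrite derive_cst.
exact: IH.
Qed.

Lemma CkD {W : normedModType R} k U (f g : 'rV[R]_m -> W) :
  open U -> Ck k U f -> Ck k U g -> Ck k U (f + g).
Proof.
move=> oU; elim: k f g => [|k IH] f g.
  by move=> cf cg x Ux; apply: continuousD; [exact: (cf x Ux)|exact: (cg x Ux)].
move=> [df Df] [dg Dg]; split=> [x Ux|v].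
  by apply: differentiableD; [exact: df|exact: dg].
apply: (@Ck_eq _ _ _ ('D_v f + 'D_v g)) => //; last exact: IH (Df v) (Dg v).
move=> x Ux; rewrite deriveD //; apply: diff_derivable; [exact: df|exact: dg].
Qed.

Lemma Ck_sum {W : normedModType R} k U n (f : 'I_n -> 'rV[R]_m -> W) :
  open U -> (forall i, Ck k U (f i)) -> Ck k U (fun x => \sum_i f i x).
Proof.
move=> oU; elim: n f => [|n IH] f Cf.
  rewrite (_ : (fun _ => _) = cst 0); first exact: Ck_cst.
  by apply/funext => x; rewrite big_ord0.
rewrite (_ : (fun _ => _) = f ord0 + (fun x => \sum_i f (lift ord0 i) x)).
  by apply: CkD => //; exact: IH.
by apply/funext => x; rewrite big_ord_recl.
Qed.

Lemma CkM k U (f g : 'rV[R]_m -> R) :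
  open U -> Ck k U f -> Ck k U g -> Ck k U (f * g).
Proof.
move=> oU; elim: k f g => [|k IH] f g.
  by move=> cf cg x Ux; apply: continuousM; [exact: (cf x Ux)|exact: (cg x Ux)].
move=> Cf Cg; have [df Df] := Cf; have [dg Dg] := Cg.
split=> [x Ux|v].
  by apply: differentiableM; [exact: df|exact: dg].
apply: (@Ck_eq _ _ _ (f * 'D_v g + g * 'D_v f)) => //.
  move=> x Ux; rewrite deriveM //; apply: diff_derivable; [exact: df|exact: dg].
by apply: CkD => //; apply: IH => //; first [exact: Dg|exact: Df|exact: CkW].
Qed.

Lemma CkZl {W : normedModType R} k U (c : 'rV[R]_m -> R) (w : W) :
  Ck k U c -> open U -> Ck k U (fun x => c x *: w).
Proof.
move=> + oU; elim: k c => [|k IH] c.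
  by move=> cc x Ux; exact: cvgZr_tmp (cc x Ux).
move=> [dc Dc]; split=> [x Ux|v]; first by apply: differentiableZl; exact: dc.
apply: (@Ck_eq _ _ _ (fun x => 'D_v c x *: w)) => //; last exact: IH (Dc v).
move=> x Ux; rewrite !deriveE //; [|exact: differentiableZl (dc _ Ux)|exact: dc].
by rewrite diffZl //; exact: dc.
Qed.

Lemma Ck_linear {V W : normedModType R} k U (L : {linear V -> W})
    (f : 'rV[R]_m -> V) :
  continuous L -> open U -> Ck k U f -> Ck k U (L \o f).
Proof.
move=> cL oU; elim: k f => [|k IH] f.
  by move=> cf x Ux; apply: continuous_comp; [exact: (cf x Ux)|exact: cL].
move=> [df Df]; have dLf x : U x -> differentiable (L \o f) x.
  move=> Ux; apply: differentiable_comp; first exact: df.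
  exact: linear_differentiable.
split=> // v; apply: (@Ck_eq _ _ _ (L \o 'D_v f)) => //; last exact: IH (Df v).
move=> x Ux /=; rewrite (deriveE v (dLf _ Ux)) (deriveE v (df _ Ux)).
rewrite (diff_comp (df _ Ux) (linear_differentiable (f x) cL)) /=.
by rewrite (diff_lin _ cL).
Qed.

Lemma Ck_id k U : Ck k U (id : 'rV[R]_m -> 'rV[R]_m).
Proof.
case: k => [|k]; first by move=> x _; exact: cvg_id.
split=> [x _|v]; first by [].
rewrite (_ : 'D_v id = cst v); first exact: Ck_cst.
by apply/funext => x; rewrite derive_id.
Qed.

Lemma Ck_coordP n k U (f : 'rV[R]_m -> 'rV[R]_n) :
  open U -> Ck k U f <-> forall j, Ck k U (fun x => f x 0 j).
Proof.
move=> oU; split=> [Cf j|Cf].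
  have @L : {linear 'rV[R]_n -> R}.
    by exists (fun N : 'M[R]_(_, _) => N 0 j); do 2![eexists]; do ?[constructor];
     rewrite ?mxE// => ? *; rewrite ?mxE//; move=> ?; rewrite !mxE.
  by have := @Ck_linear _ _ k U L f (@coord_continuous _ _ _ 0 j) oU Cf.
apply: (@Ck_eq _ _ _ (fun x => \sum_j f x 0 j *: delta_mx 0 j)) => //.
  by move=> x _; rewrite -row_sum_delta.
by apply: Ck_sum => // j; exact: CkZl.
Qed.

End Ck_theory.

Lemma Ck_comp {m n : nat} k U V (f : 'rV[R]_m -> 'rV[R]_n) (g : 'rV[R]_n -> R) :
  open U -> open V -> (forall x, U x -> V (f x)) ->
  Ck k U f -> Ck k V g -> Ck k U (g \o f).
Proof.
move=> oU oV UV; elim: k g => [|k IH] g.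
  move=> cf cg x Ux; apply: continuous_comp; first exact: (cf x Ux).
  exact/cg/UV.
move=> Cf [dg Dg]; have [df Df] := Cf.
have dgf x : U x -> differentiable (g \o f) x.
  move=> Ux; apply: differentiable_comp; first exact: df.
  exact/dg/UV.
split=> // v; apply: (@Ck_eq _ _ _ _ (fun x =>
  \sum_j ((fun y => 'D_v f y 0 j) * ('D_(delta_mx 0 j) g \o f)) x)) => //.
  move=> x Ux; rewrite (deriveE v (dgf _ Ux)).
  rewrite (diff_comp (df _ Ux) (dg _ (UV _ Ux))) /= -(deriveE v (df _ Ux)).
  rewrite [in RHS](row_sum_delta ('D_v f x)) linear_sum /=.
  apply: eq_bigr => j _; by rewrite linearZ /= -(deriveE _ (dg _ (UV _ Ux))).
apply: Ck_sum => // j; apply: CkM => //.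
  by have /(Ck_coordP _ _ oU) := Df v; apply.
by apply: IH => //; first [exact: Dg|exact: CkW].
Qed.

Lemma Cinfty_comp {m n p : nat} U V (f : 'rV[R]_m -> 'rV[R]_n)
    (g : 'rV[R]_n -> 'rV[R]_p) :
  open U -> open V -> (forall x, U x -> V (f x)) ->
  Cinfty U f -> Cinfty V g -> Cinfty U (g \o f).
Proof.
move=> oU oV UV Cf Cg k; apply/Ck_coordP => // j.
apply: (@Ck_comp _ _ k U V f (fun y => g y 0 j)) => //.
by have /(Ck_coordP _ _ oV) := Cg k; apply.
Qed.

Lemma Cinfty_eq {m : nat} {W : normedModType R} U (f g : 'rV[R]_m -> W) :
  open U -> (forall x, U x -> f x = g x) -> Cinfty U f -> Cinfty U g.
Proof. by move=> oU fg Cf k; exact: Ck_eq (Cf k). Qed.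

Lemma Cinfty_sub {m : nat} {W : normedModType R} U V (f : 'rV[R]_m -> W) :
  V `<=` U -> Cinfty U f -> Cinfty V f.
Proof. by move=> VU Cf k; exact: Ck_sub (Cf k). Qed.

Lemma Cinfty_local {m : nat} {W : normedModType R} U (f : 'rV[R]_m -> W) :
  (forall x, U x -> exists2 V, V x & Cinfty V f) -> Cinfty U f.
Proof.
by move=> loc k; apply: Ck_local => x /loc[V Vx Cf]; exists V => //; exact: Cf.
Qed.

Lemma Cinfty_linear {m p n : nat} U (L : {linear 'rV[R]_p -> 'rV[R]_n})
    (f : 'rV[R]_m -> 'rV[R]_p) :
  continuous L -> open U -> Cinfty U f -> Cinfty U (L \o f).
Proof. by move=> cL oU Cf k; exact: Ck_linear. Qed.

Lemma Cinfty_row_mx {m n1 n2 : nat} U (f : 'rV[R]_m -> 'rV[R]_n1)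
    (g : 'rV[R]_m -> 'rV[R]_n2) :
  open U -> Cinfty U f -> Cinfty U g ->
  Cinfty U (fun x => row_mx (f x) (g x)).
Proof.
move=> oU Cf Cg k; apply/Ck_coordP => // j; case: (split_ordP j) => {}j ->.
  under [X in Ck _ _ X]funext do rewrite row_mxEl.
  by have /(Ck_coordP _ _ oU) := Cf k; apply.
under [X in Ck _ _ X]funext do rewrite row_mxEr.
by have /(Ck_coordP _ _ oU) := Cg k; apply.
Qed.

End EuclideanSmoothness.

(* M^k, with the product topology and the product manifold structure. *)
Definition power (M : Type) (k : nat) : Type := 'I_k -> M.

HB.instance Definition _ (M : topologicalType) (k : nat) :=
  Topological.copy (power M k) (prod_topology (fun _ : 'I_k => M)).

Section Topology.

Lemma second_countableI (T : topologicalType) (I : countType) (e : I -> set T) :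
  (forall i, open (e i)) ->
  (forall x A, nbhs x A -> exists2 i, e i x & e i `<=` A) ->
  @second_countable T.
Proof.
move=> oe be; exists (range e).
  by apply: (sub_countable (card_image_le _ _)); exact: countableP.
split=> [_ [i _ <-] //|x A /be[i eix eiA]].
by exists (e i) => //; split=> //; exists i.
Qed.

Lemma second_countableE (T : topologicalType) : @second_countable T ->
  exists e : nat -> set T, (forall i, open (e i)) /\
    forall x A, nbhs x A -> exists2 i, e i x & e i `<=` A.
Proof.
move=> [B /countable_injP[f finj] [Bopen Bbase]].
exists (fun n => \bigcup_(A in [set A | B A /\ f A = n]) A); split=> [n|x A].
  by apply: bigcup_open => A [/Bopen].
move=> /Bbase[V [BV Vx] VA]; exists (f V); first by exists V.
move=> y [W [BW fWV] Wy]; apply: VA.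
by rewrite -(finj W V) ?inE.
Qed.

Lemma second_countable_prod (T U : topologicalType) :
  @second_countable T -> @second_countable U ->
  @second_countable (T * U)%type.
Proof.
move=> /second_countableE[d [od bd]] /second_countableE[e [oe be]].
apply: (@second_countableI _ (nat * nat)%type (fun n => d n.1 `*` e n.2)).
  move=> n; rewrite openE => y [dy ey]; exists (d n.1, e n.2) => //.
  by split; apply: open_nbhs_nbhs; split=> //=.
move=> x A [[P Q] [/bd[i dix diP] /be[j ejx ejQ]] PQA].
exists (i, j) => // y [diy ejy]; apply: PQA.
by split; [exact: diP|exact: ejQ].
Qed.

Lemma hausdorff_prod (T U : topologicalType) :
  hausdorff_space T -> hausdorff_space U -> hausdorff_space (T * U)%type.
Proof.
move=> hT hU p q clpq; rewrite (surjective_pairing p) (surjective_pairing q).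
congr pair; [apply: hT|apply: hU] => A B nA nB.
  have nA' : nbhs p (fst @^-1` A) by exact: (@cvg_fst _ _ (nbhs p.1)) nA.
  have nB' : nbhs q (fst @^-1` B) by exact: (@cvg_fst _ _ (nbhs q.1)) nB.
  by have [z [Az Bz]] := clpq _ _ nA' nB'; exists z.1.
have nA' : nbhs p (snd @^-1` A) by exact: (@cvg_snd _ _ _ (nbhs p.2)) nA.
have nB' : nbhs q (snd @^-1` B) by exact: (@cvg_snd _ _ _ (nbhs q.2)) nB.
by have [z [Az Bz]] := clpq _ _ nA' nB'; exists z.2.
Qed.

Section power.
Context {M : topologicalType} {k : nat}.

Lemma power_proj_continuous (i : 'I_k) : continuous (fun f : power M k => f i).
Proof. exact: (@proj_continuous 'I_k (fun=> M) i). Qed.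

Lemma nbhs_powerP (f : power M k) (A : set (power M k)) :
  nbhs f A <-> exists2 P : 'I_k -> set M,
    (forall i, nbhs (f i) (P i)) & [set g | forall i, P i (g i)] `<=` A.
Proof.
split; last first.
  move=> [P nP PA]; apply: filterS PA _.
  apply: (@filter_forall (power M k) _ (fun i => [set g | P i (g i)])
    (nbhs f) (nbhs_filter f)) => i.
  exact: power_proj_continuous (nP i).
pose F : set_system (power M k) := [set A | exists2 P : 'I_k -> set M,
    (forall i, nbhs (f i) (P i)) & [set g | forall i, P i (g i)] `<=` A].
have FF : Filter F.
  split.
  - by exists (fun=> setT) => // i; exact: filterT.
  - move=> B C [P nP PB] [Q nQ QC]; exists (fun i => P i `&` Q i).
      by move=> i; exact: filterI.
    by move=> g PQg; split; [apply: PB|apply: QC] => i; have [] := PQg i.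
  - by move=> B C BC [P nP PB]; exists P => // g /PB/BC.
suff : F --> f by apply.
apply/cvg_sup => i B; rewrite nbhsE => -[_ [[V oV <-] Vfi] VB].
exists (fun j => if j == i then V else setT).
  by move=> j; case: eqP => [->|_]; [exact: open_nbhs_nbhs|exact: filterT].
by move=> g /(_ i); rewrite eqxx => Vgi; exact: VB.
Qed.

Lemma second_countable_power :
  @second_countable M -> @second_countable (power M k).
Proof.
move=> /second_countableE[e [oe be]].
apply: (@second_countableI (power M k) {ffun 'I_k -> nat}
  (fun n => [set g : power M k | forall i, e (n i) (g i)])).
  move=> n; rewrite openE => g eg; apply/nbhs_powerP.
  by exists (fun i => e (n i)) => // i; apply: open_nbhs_nbhs; split.
move=> f A /nbhs_powerP[P nP PA].
have /choice[n nE] i : exists n, e n (f i) /\ e n `<=` P i.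
  by have [n] := be _ _ (nP i); exists n.
exists [ffun i => n i].
  by move=> i; rewrite ffunE; have [] := nE i.
by move=> g eg; apply: PA => i; have [_] := nE i; apply; have := eg i; rewrite ffunE.
Qed.

Lemma hausdorff_power : hausdorff_space M -> hausdorff_space (power M k).
Proof. by move=> hM; exact: (@hausdorff_product 'I_k (fun=> M)). Qed.

End power.

Lemma second_countable_real (R : realType) : @second_countable R.
Proof.
apply: (@second_countableI _ (rat * rat)%type
  (fun q => `](ratr q.1 : R), ratr q.2[%classic)).
  by move=> q; exact: interval_open.
move=> x A /nbhs_ballP[e /= e0 xA].
have xe1 : x - e < x by rewrite ltrBlDr ltrDl.
have xe2 : x < x + e by rewrite ltrDl.
have [p] := rat_in_itvoo xe1; rewrite in_itv /= => /andP[p1 p2].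
have [q] := rat_in_itvoo xe2; rewrite in_itv /= => /andP[q1 q2].
exists (p, q); first by rewrite /= in_itv /= p2 q1.
move=> y /=; rewrite in_itv /= => /andP[py yq]; apply: xA.
rewrite /ball /= ltr_distlC (lt_trans p1 py) /=.
by rewrite (lt_trans yq q2).
Qed.

Lemma second_countable_rV (R : realType) n : @second_countable 'rV[R]_n.
Proof.
have /second_countableE[e [oe be]] := @second_countable_real R.
apply: (@second_countableI _ {ffun 'I_n -> nat}
  (fun m => [set g : 'rV[R]_n | forall i, e (m i) (g 0 i)])).
  move=> m; rewrite openE => g eg.
  exists (fun i j => e (m j)) => [i j|h eh]; last by move=> j; exact: eh.
  by rewrite (ord1 i); apply: open_nbhs_nbhs; split.
move=> f A [P nP PA].
have /choice[m mE] i : exists m, e m (f 0 i) /\ e m `<=` P 0 i.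
  by have [m] := be _ _ (nP 0 i); exists m.
exists [ffun i => m i].
  by move=> i; rewrite ffunE; have [] := mE i.
move=> g eg; apply: PA => i j; rewrite (ord1 i).
by have [_] := mE j; apply; have := eg j; rewrite ffunE.
Qed.

End Topology.

Lemma open_preimage_on (S T : topologicalType) (U : set S) (f : S -> T)
    (V : set T) :
  open U -> (forall x, U x -> {for x, continuous f}) -> open V ->
  open (U `&` f @^-1` V).
Proof.
move=> oU cf oV; rewrite openE => x [Ux Vfx].
apply: filterI; first exact: open_nbhs_nbhs.
by apply: (cf x Ux); exact: open_nbhs_nbhs.
Qed.

(* A homeomorphism from an open subset of T onto an open subset of R^n.
   The maps cmap and cinv are total; only their restrictions to cdom and cimg
   are meaningful. *)
Record chart (R : realType) (T : topologicalType) (n : nat) := Chart {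
  cdom : set T;
  cimg : set 'rV[R]_n;
  cmap : T -> 'rV[R]_n;
  cinv : 'rV[R]_n -> T;
  cdom_open : open cdom;
  cimg_open : open cimg;
  cmap_img : forall x, cdom x -> cimg (cmap x);
  cinv_dom : forall v, cimg v -> cdom (cinv v);
  cmapK : forall x, cdom x -> cinv (cmap x) = x;
  cinvK : forall v, cimg v -> cmap (cinv v) = v;
  cmap_continuous : forall x, cdom x -> {for x, continuous cmap};
  cinv_continuous : forall v, cimg v -> {for v, continuous cinv}
}.

HB.mixin Record isManifold (R : realType) M of Topological M := {
  mdim : nat;
  atlas : set (chart R M mdim);
  atlas_cover : forall x : M, exists2 c, atlas c & cdom c x;
  atlas_smooth : forall c d, atlas c -> atlas d ->
    Cinfty (cimg c `&` cinv c @^-1` cdom d) (cmap d \o cinv c);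
  manifold_hausdorff : hausdorff_space M;
  manifold_second_countable : @second_countable M
}.

#[short(type="manifoldType")]
HB.structure Definition Manifold (R : realType) :=
  {M of isManifold R M & Topological M}.

Arguments mdim {R} M : rename.
Arguments atlas {R} M : rename.

Section Euclidean.
Context {R : realType} {n : nat}.

Definition rV_chart : chart R 'rV[R]_n n :=
  @Chart R 'rV[R]_n n setT setT id id openT openT
    (fun _ _ => I) (fun _ _ => I) (fun _ _ => erefl) (fun _ _ => erefl)
    (fun _ _ => cvg_id) (fun _ _ => cvg_id).

Lemma rV_cover (x : 'rV[R]_n) : exists2 c, [set rV_chart] c & cdom c x.
Proof. by exists rV_chart. Qed.

Lemma rV_smooth c d : [set rV_chart] c -> [set rV_chart] d ->
  Cinfty (cimg c `&` cinv c @^-1` cdom d) (cmap d \o cinv c).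
Proof. by move=> -> -> k; exact: Ck_id. Qed.

Lemma rV_hausdorff : hausdorff_space 'rV[R]_n.
Proof. exact: norm_hausdorff. Qed.

HB.instance Definition _ := isManifold.Build R 'rV[R]_n
  rV_cover rV_smooth rV_hausdorff (@second_countable_rV R n).
End Euclidean.

Section Product.
Context {R : realType} {M N : manifoldType R}.

Section chart.
Context {m n : nat} (c : chart R M m) (d : chart R N n).

Definition prod_chart_dom : set (M * N) := cdom c `*` cdom d.
Definition prod_chart_img : set 'rV[R]_(m + n) :=
  lsubmx @^-1` cimg c `&` rsubmx @^-1` cimg d.
Definition prod_chart_map (x : M * N) : 'rV[R]_(m + n) :=
  row_mx (cmap c x.1) (cmap d x.2).
Definition prod_chart_inv (v : 'rV[R]_(m + n)) : M * N :=
  (cinv c (lsubmx v), cinv d (rsubmx v)).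

Lemma prod_chart_dom_open : open prod_chart_dom.
Proof.
rewrite openE => x [cx dx]; exists (cdom c, cdom d) => //.
by split; apply: open_nbhs_nbhs; split=> //; exact: cdom_open.
Qed.

Lemma prod_chart_img_open : open prod_chart_img.
Proof.
apply: openI; apply: open_comp; try exact: cimg_open.
  by move=> v _; exact: continuous_lsubmx.
by move=> v _; exact: continuous_rsubmx.
Qed.

Lemma prod_chart_map_img x : prod_chart_dom x -> prod_chart_img (prod_chart_map x).
Proof.
move=> [cx dx]; rewrite /prod_chart_img /= row_mxKl row_mxKr.
by split; exact: cmap_img.
Qed.

Lemma prod_chart_inv_dom v : prod_chart_img v -> prod_chart_dom (prod_chart_inv v).
Proof. by move=> [cv dv]; split; exact: cinv_dom. Qed.

Lemma prod_chart_mapK x : prod_chart_dom x -> prod_chart_inv (prod_chart_map x) = x.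
Proof.
case: x => x y [/= cx dy]; rewrite /prod_chart_inv row_mxKl row_mxKr /=.
by rewrite !cmapK.
Qed.

Lemma prod_chart_invK v : prod_chart_img v -> prod_chart_map (prod_chart_inv v) = v.
Proof. by move=> [cv dv]; rewrite /prod_chart_map /= !cinvK // hsubmxK. Qed.

Lemma prod_chart_map_continuous x : prod_chart_dom x -> {for x, continuous prod_chart_map}.
Proof.
move=> [cx dx] A [P nP PA].
pose Pl := [set u : 'rV[R]_m | forall i j, P i (lshift n j) (u i j)].
pose Pr := [set u : 'rV[R]_n | forall i j, P i (rshift m j) (u i j)].
have nl : nbhs (cmap c x.1) Pl.
  exists (fun i j => P i (lshift n j)) => // i j.
  by have := nP i (lshift n j); rewrite row_mxEl.
have nr : nbhs (cmap d x.2) Pr.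
  exists (fun i j => P i (rshift m j)) => // i j.
  by have := nP i (rshift m j); rewrite row_mxEr.
exists (cmap c @^-1` Pl, cmap d @^-1` Pr).
  by split; [exact: (cmap_continuous cx)|exact: (cmap_continuous dx)].
move=> y [/= ly ry]; apply: PA => i j.
by case: (split_ordP j) => {}j ->; rewrite ?row_mxEl ?row_mxEr; [exact: ly|exact: ry].
Qed.

Lemma prod_chart_inv_continuous v : prod_chart_img v -> {for v, continuous prod_chart_inv}.
Proof.
move=> [cv dv].
have c1 : {for v, continuous (cinv c \o lsubmx)}.
  by apply: continuous_comp; [exact: continuous_lsubmx|exact: cinv_continuous].
have c2 : {for v, continuous (cinv d \o rsubmx)}.
  by apply: continuous_comp; [exact: continuous_rsubmx|exact: cinv_continuous].
by apply: cvg_pair c1 c2; exact: nbhs_filter.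
Qed.

Definition prod_chart : chart R (M * N)%type (m + n) :=
  Chart prod_chart_dom_open prod_chart_img_open prod_chart_map_img prod_chart_inv_dom prod_chart_mapK prod_chart_invK
    prod_chart_map_continuous prod_chart_inv_continuous.
End chart.

Definition prod_atlas : set (chart R (M * N)%type (mdim M + mdim N)) :=
  [set prod_chart c d | c in atlas M & d in atlas N].

Lemma prod_cover (x : M * N) : exists2 c, prod_atlas c & cdom c x.
Proof.
have [c Mc cx] := atlas_cover x.1; have [d Nd dx] := atlas_cover x.2.
by exists (prod_chart c d) => //; exists c => //; exists d.
Qed.

Lemma prod_smooth c d : prod_atlas c -> prod_atlas d ->
  Cinfty (cimg c `&` cinv c @^-1` cdom d) (cmap d \o cinv c).
Proof.
move=> [c1 Mc1 [c2 Nc2 <-]] [d1 Md1 [d2 Nd2 <-]].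
set U := _ `&` _.
have oU : open U.
  apply: open_preimage_on; try exact: cdom_open; first exact: cimg_open.
  exact: cinv_continuous.
have oV1 : open (cimg c1 `&` cinv c1 @^-1` cdom d1).
  apply: open_preimage_on; try exact: cdom_open; first exact: cimg_open.
  exact: cinv_continuous.
have oV2 : open (cimg c2 `&` cinv c2 @^-1` cdom d2).
  apply: open_preimage_on; try exact: cdom_open; first exact: cimg_open.
  exact: cinv_continuous.
apply: (@Cinfty_row_mx _ _ _ _ _ ((cmap d1 \o cinv c1) \o lsubmx)
  ((cmap d2 \o cinv c2) \o rsubmx)) => //.
- apply: (Cinfty_comp oU oV1 _ _ (atlas_smooth _ _ Mc1 Md1)).
    by move=> v [[/= ? ?] [/= ? ?]].
  apply: (@Cinfty_linear _ _ _ _ _ lsubmx id _ oU) => [|k]; last exact: Ck_id.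
  exact: continuous_lsubmx.
- apply: (Cinfty_comp oU oV2 _ _ (atlas_smooth _ _ Nc2 Nd2)).
    by move=> v [[/= ? ?] [/= ? ?]].
  apply: (@Cinfty_linear _ _ _ _ _ rsubmx id _ oU) => [|k]; last exact: Ck_id.
  exact: continuous_rsubmx.
Qed.

HB.instance Definition _ := isManifold.Build R (M * N)%type
  prod_cover prod_smooth
  (hausdorff_prod (@manifold_hausdorff R M) (@manifold_hausdorff R N))
  (second_countable_prod (@manifold_second_countable R M)
    (@manifold_second_countable R N)).
End Product.

Section Power.
Context {R : realType} {M : manifoldType R} {k : nat}.

Section chart.
Context {n : nat} (c : 'I_k -> chart R M n).

Definition power_chart_coord (i : 'I_k) (v : 'rV[R]_(k * n)) : 'rV[R]_n :=
  row i (vec_mx v).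

Definition power_chart_dom : set (power M k) :=
  [set x | forall i, cdom (c i) (x i)].
Definition power_chart_img : set 'rV[R]_(k * n) :=
  [set v | forall i, cimg (c i) (power_chart_coord i v)].
Definition power_chart_map (x : power M k) : 'rV[R]_(k * n) :=
  mxvec (\matrix_(i < k) cmap (c i) (x i)).
Definition power_chart_inv (v : 'rV[R]_(k * n)) : power M k :=
  fun i => cinv (c i) (power_chart_coord i v).

Lemma power_chart_coord_continuous i : continuous (power_chart_coord i).
Proof.
move=> v A [P nP PA].
exists (fun a b => [set y | forall j, mxvec_index i j = b -> P 0 j y]).
  move=> a b; rewrite (ord1 a); case/mxvec_indexP: b => i' j'.
  have := nP 0 j'; rewrite /power_chart_coord !mxE => nPj.
  have [ii'|ii'] := eqVneq i i'; last first.
    apply: filterS (@filterT _ _ _) => y _ j.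
    by move=> /cast_ord_inj/enum_rank_inj[/eqP]; rewrite (negPf ii').
  subst i'; apply: filterS nPj => y Py j.
  by move=> /cast_ord_inj/enum_rank_inj[->].
move=> w Pw; apply: PA => a j; rewrite (ord1 a) /power_chart_coord !mxE.
exact: Pw.
Qed.

Lemma power_chart_coordE i x : power_chart_coord i (power_chart_map x) = cmap (c i) (x i).
Proof. by rewrite /power_chart_coord /power_chart_map mxvecK rowK. Qed.

Lemma power_chart_dom_open : open power_chart_dom.
Proof.
rewrite openE => x cx; apply/nbhs_powerP; exists (fun i => cdom (c i)) => // i.
by apply: open_nbhs_nbhs; split=> //; exact: cdom_open.
Qed.

Lemma power_chart_img_open : open power_chart_img.
Proof.
rewrite openE => v cv.
apply: (@filter_forall _ _ (fun i => [set v | cimg (c i) (power_chart_coord i v)])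
  (nbhs v) (nbhs_filter v)) => i.
apply: (power_chart_coord_continuous (x := v)); apply: open_nbhs_nbhs.
by split; [exact: cimg_open|exact: cv].
Qed.

Lemma power_chart_map_img x : power_chart_dom x -> power_chart_img (power_chart_map x).
Proof. by move=> cx i; rewrite power_chart_coordE; exact: cmap_img. Qed.

Lemma power_chart_inv_dom v : power_chart_img v -> power_chart_dom (power_chart_inv v).
Proof. by move=> cv i; exact: cinv_dom. Qed.

Lemma power_chart_mapK x : power_chart_dom x -> power_chart_inv (power_chart_map x) = x.
Proof. by move=> cx; apply/funext => i; rewrite /power_chart_inv power_chart_coordE cmapK. Qed.

Lemma power_chart_invK v : power_chart_img v -> power_chart_map (power_chart_inv v) = v.
Proof.
move=> cv; rewrite -[RHS]vec_mxK; congr mxvec.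
by apply/row_matrixP => i; rewrite rowK cinvK.
Qed.

Lemma power_chart_map_continuous x : power_chart_dom x -> {for x, continuous power_chart_map}.
Proof.
move=> cx A [P nP PA]; apply/nbhs_powerP.
exists (fun i => cmap (c i) @^-1`
  [set u : 'rV[R]_n | forall a j, P a (mxvec_index i j) (u 0 j)]).
  move=> i; apply: (cmap_continuous (cx i)).
  exists (fun a j => P a (mxvec_index i j)).
    move=> a j; have := nP a (mxvec_index i j).
    by rewrite (ord1 a) /power_chart_map mxvecE mxE.
  by move=> u Pu a j; rewrite (ord1 a); exact: Pu.
move=> y Py; apply: PA => a b; case/mxvec_indexP: b => i j.
rewrite (ord1 a) /power_chart_map mxvecE mxE; exact: Py.
Qed.

Lemma power_chart_inv_continuous v : power_chart_img v -> {for v, continuous power_chart_inv}.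
Proof.
move=> cv A /nbhs_powerP[P nP PA].
suff : nbhs v [set w | forall i, P i (power_chart_inv w i)].
  by apply: filterS => w Pw; exact: PA.
apply: (@filter_forall _ _ (fun i => [set w | P i (power_chart_inv w i)])
  (nbhs v) (nbhs_filter v)) => i.
have : {for v, continuous (cinv (c i) \o power_chart_coord i)}.
  by apply: continuous_comp; [exact: power_chart_coord_continuous|exact: cinv_continuous].
by apply; exact: nP.
Qed.

Definition power_chart : chart R (power M k) (k * n) :=
  Chart power_chart_dom_open power_chart_img_open power_chart_map_img power_chart_inv_dom power_chart_mapK power_chart_invK
    power_chart_map_continuous power_chart_inv_continuous.
End chart.

Definition power_atlas : set (chart R (power M k) (k * mdim M)) :=
  [set power_chart c | c in [set c | forall i, atlas M (c i)]].

Lemma power_cover (x : power M k) : exists2 c, power_atlas c & cdom c x.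
Proof.
have /choice[c cP] i : exists c, atlas M c /\ cdom c (x i).
  by have [c Mc cx] := atlas_cover (x i); exists c.
exists (power_chart c); last by move=> i; have [] := cP i.
by exists c => // i; have [] := cP i.
Qed.

Lemma power_smooth c d : power_atlas c -> power_atlas d ->
  Cinfty (cimg c `&` cinv c @^-1` cdom d) (cmap d \o cinv c).
Proof.
move=> [{}c Mc <-] [{}d Md <-].
set U := _ `&` _.
have oU : open U.
  apply: open_preimage_on; try exact: cdom_open; first exact: cimg_open.
  exact: cinv_continuous.
move=> l; apply/Ck_coordP => // b; case/mxvec_indexP: b => i j.
have oV : open (cimg (c i) `&` cinv (c i) @^-1` cdom (d i)).
  apply: open_preimage_on; try exact: cdom_open; first exact: cimg_open.
  exact: cinv_continuous.
have -> : (fun v => (cmap (power_chart d) \o cinv (power_chart c)) v 0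
    (mxvec_index i j)) =
  (fun u : 'rV[R]_(mdim M) => u 0 j) \o
    ((cmap (d i) \o cinv (c i)) \o (row i \o vec_mx)).
  by apply/funext => v /=; rewrite mxvecE mxE.
suff Cu : Cinfty U ((cmap (d i) \o cinv (c i)) \o (row i \o vec_mx)).
  by have /(Ck_coordP _ _ oU) := Cu l; apply.
apply: (Cinfty_comp oU oV _ _ (atlas_smooth _ _ (Mc i) (Md i))).
  by move=> v [/(_ i) ? /(_ i) ?].
move=> l'; apply/Ck_coordP => // j'.
have -> : (fun v : 'rV[R]_(k * mdim M) => (row i \o vec_mx) v 0 j') =
    (fun v => v 0 (mxvec_index i j')).
  by apply/funext => v; rewrite /= !mxE.
by have /(Ck_coordP _ _ oU) := @Ck_id R _ l' U; apply.
Qed.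

HB.instance Definition _ := isManifold.Build R (power M k)
  power_cover power_smooth
  (hausdorff_power (@manifold_hausdorff R M))
  (second_countable_power (@manifold_second_countable R M)).
End Power.

Section SmoothMaps.
Context {R : realType}.

(* f maps a neighbourhood cinv c @` Q of x lying in a chart c of M into a
   chart d of N, and is C^oo there when read in these charts. *)
Definition smooth_at {M N : manifoldType R} (f : M -> N) (x : M) : Prop :=
  exists c d, [/\ atlas M c, atlas N d, cdom c x &
    exists Q : set 'rV[R]_(mdim M),
    [/\ open Q, Q (cmap c x), Q `<=` cimg c `&` (f \o cinv c) @^-1` cdom d &
      Cinfty Q (cmap d \o f \o cinv c)]].

Definition smooth {M N : manifoldType R} (f : M -> N) : Prop :=
  forall x, smooth_at f x.

Lemma smooth_at_continuous {M N : manifoldType R} (f : M -> N) x :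
  smooth_at f x -> {for x, continuous f}.
Proof.
move=> [c [d [Mc Nd cx [Q [oO Ox Osub CO]]]]].
have cfc := CO 0%N _ Ox.
have /Osub[_ /= dfx] := Ox; rewrite cmapK // in dfx.
have ccont : {for x, continuous (cinv d \o (cmap d \o f \o cinv c) \o cmap c)}.
  apply: continuous_comp; first exact: cmap_continuous.
  apply: continuous_comp; first exact: cfc.
  by rewrite /= cmapK //; apply/cinv_continuous/cmap_img.
have E : \near x, (cinv d \o (cmap d \o f \o cinv c) \o cmap c) x = f x.
  have oD : open (cdom c `&` cmap c @^-1` Q).
    by apply: open_preimage_on => //; [exact: cdom_open|exact: cmap_continuous].
  apply: filterS (open_nbhs_nbhs (conj oD (conj cx Ox))) => y [cy /Osub[_ /=]].
  by rewrite cmapK // => dfy; rewrite cmapK.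
rewrite /prop_for /continuous_at -(nbhs_singleton E).
apply: cvg_trans ccont; apply: near_eq_cvg E; exact: nbhs_filter.
Qed.

Lemma smooth_at_near {M N : manifoldType R} (f g : M -> N) x :
  (\near x, f x = g x) -> smooth_at f x -> smooth_at g x.
Proof.
move=> fg; have : nbhs x [set y | f y = g y] by exact: fg.
rewrite nbhsE => -[W [oW Wx] WE] [c [d [Mc Nd cx [Q [oO Ox Osub CO]]]]].
have Ocimg : Q `<=` cimg c by move=> v /Osub[].
have oO' : open (Q `&` cinv c @^-1` W).
  by apply: open_preimage_on => // v /Ocimg; exact: cinv_continuous.
have E v : (Q `&` cinv c @^-1` W) v -> f (cinv c v) = g (cinv c v).
  by move=> [_ /WE].
exists c, d; split=> //; exists (Q `&` cinv c @^-1` W); split=> //.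
- by split=> //=; rewrite cmapK.
- by move=> v Ov; have [/Osub[cv dv] _] := Ov; split=> //=; rewrite -E.
- apply: (Cinfty_eq (f := cmap d \o f \o cinv c)) => //.
    by move=> v /E /= ->.
  by apply: Cinfty_sub CO => v [].
Qed.

Lemma smooth_at_charts {M N : manifoldType R} (f : M -> N) x c d :
  smooth_at f x -> atlas M c -> atlas N d -> cdom c x -> cdom d (f x) ->
  exists Q : set 'rV[R]_(mdim M),
    [/\ open Q, Q (cmap c x), Q `<=` cimg c `&` (f \o cinv c) @^-1` cdom d &
      Cinfty Q (cmap d \o f \o cinv c)].
Proof.
move=> fx Mc Nd cx dfx; have cf := smooth_at_continuous fx.
have [c' [d' [Mc' Nd' cx' [Q [oO Ox Osub CO]]]]] := fx.
set V1 := cimg c `&` cinv c @^-1` cdom c'.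
have oV1 : open V1.
  apply: open_preimage_on; try exact: cdom_open; first exact: cimg_open.
  exact: cinv_continuous.
set V2 := cimg d' `&` cinv d' @^-1` cdom d.
have oV2 : open V2.
  apply: open_preimage_on; try exact: cdom_open; first exact: cimg_open.
  exact: cinv_continuous.
have C1 : Cinfty V1 (cmap c' \o cinv c) by exact: atlas_smooth.
have C2 : Cinfty V2 (cmap d \o cinv d') by exact: atlas_smooth.
pose O2 := Q `&` (cmap d' \o f \o cinv c') @^-1` V2.
have oO2 : open O2 by apply: open_preimage_on => // v Ov; exact: (CO 0%N v Ov).
pose O1 := V1 `&` (cmap c' \o cinv c) @^-1` O2.
have oO1 : open O1 by apply: open_preimage_on => // v V1v; exact: (C1 0%N v V1v).
have O1f v : O1 v -> cinv d' (cmap d' (f (cinv c' (cmap c' (cinv c v))))) =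
    f (cinv c v).
  move=> [[cv c'v] [/= /Osub[_ /= d'f] _]].
  by rewrite cmapK // cmapK.
exists O1; split=> //.
- have d'fx : cdom d' (f x) by have /Osub[_ /=] := Ox; rewrite cmapK.
  split; first by split; [exact: cmap_img|rewrite /= cmapK].
  by split=> /=; rewrite !cmapK //; split=> /=; [exact: cmap_img|rewrite cmapK].
- move=> v O1v; split=> /=; first by have [[]] := O1v.
  by rewrite -O1f //; have [_ [_ []]] := O1v.
- apply: (Cinfty_eq (f := (cmap d \o cinv d') \o
    ((cmap d' \o f \o cinv c') \o (cmap c' \o cinv c)))) => //.
    by move=> v /O1f /= ->.
  apply: (Cinfty_comp oO1 oV2 _ _ C2); first by move=> v [_ []].
  apply: (Cinfty_comp oO1 oO _ _ CO); first by move=> v [_ []].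
  by apply: Cinfty_sub C1 => v [].
Qed.

Lemma smooth_at_comp {M N P : manifoldType R} (f : M -> N) (g : N -> P) x :
  smooth_at f x -> smooth_at g (f x) -> smooth_at (g \o f) x.
Proof.
move=> fx gfx; have [d [e [Nd Pe dfx [Q' [oO' Q'x Q'sub CO']]]]] := gfx.
have [c Mc cx] := atlas_cover x.
have [Q [oO Ox Osub CO]] := smooth_at_charts fx Mc Nd cx dfx.
exists c, e; split=> //.
pose O1 := Q `&` (cmap d \o f \o cinv c) @^-1` Q'.
have oO1 : open O1 by apply: open_preimage_on => // v Ov; exact: (CO 0%N v Ov).
exists O1; split=> //.
- by split=> //=; rewrite cmapK.
- move=> v [Ov /Q'sub[/= _]]; have [cv /= dv] := Osub _ Ov.
  by rewrite cmapK.
- apply: (Cinfty_eq (f := (cmap e \o g \o cinv d) \o (cmap d \o f \o cinv c))) => //.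
    by move=> v [/Osub[_ /= dv] _]; rewrite cmapK.
  apply: (Cinfty_comp oO1 oO' _ _ CO'); first by move=> v [].
  by apply: Cinfty_sub CO => v [].
Qed.

Lemma smooth_at_cst {M N : manifoldType R} (y : N) (x : M) :
  smooth_at (fun=> y) x.
Proof.
have [c Mc cx] := atlas_cover x; have [d Nd dy] := atlas_cover y.
exists c, d; split=> //; exists (cimg c); split=> //; first exact: cimg_open.
  exact: cmap_img.
by move=> k; exact: (Ck_cst (m := mdim M) k (cimg c) (cmap d y)).
Qed.

Lemma smooth_at_id {M : manifoldType R} (x : M) : smooth_at id x.
Proof.
have [c Mc cx] := atlas_cover x.
exists c, c; split=> //; exists (cimg c); split; first exact: cimg_open.
- exact: cmap_img.
- by move=> v cv; split=> //=; exact: cinv_dom.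
- apply: (Cinfty_eq (f := id)); [exact: cimg_open| |by move=> k; exact: Ck_id].
  by move=> v cv /=; rewrite cinvK.
Qed.

Lemma smooth_at_fst {M N : manifoldType R} (x : M * N) : smooth_at fst x.
Proof.
have [c Mc cx] := atlas_cover x.1; have [d Nd dx] := atlas_cover x.2.
exists (prod_chart c d), c; split=> //; first by exists c => //; exists d.
exists (cimg (prod_chart c d)); split; first exact: cimg_open.
- exact: cmap_img.
- by move=> v cv; split=> //=; apply: cinv_dom; have [] := cv.
- apply: (Cinfty_eq (f := lsubmx)); first exact: cimg_open.
    by move=> v [cv dv] /=; rewrite cinvK.
  apply: (@Cinfty_linear _ _ _ _ _ lsubmx id); first exact: continuous_lsubmx.
    exact: cimg_open.
  by move=> k; exact: Ck_id.
Qed.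

Lemma smooth_at_snd {M N : manifoldType R} (x : M * N) : smooth_at snd x.
Proof.
have [c Mc cx] := atlas_cover x.1; have [d Nd dx] := atlas_cover x.2.
exists (prod_chart c d), d; split=> //; first by exists c => //; exists d.
exists (cimg (prod_chart c d)); split; first exact: cimg_open.
- exact: cmap_img.
- by move=> v cv; split=> //=; apply: cinv_dom; have [] := cv.
- apply: (Cinfty_eq (f := rsubmx)); first exact: cimg_open.
    by move=> v [cv dv] /=; rewrite cinvK.
  apply: (@Cinfty_linear _ _ _ _ _ rsubmx id); first exact: continuous_rsubmx.
    exact: cimg_open.
  by move=> k; exact: Ck_id.
Qed.

Lemma smooth_at_pair {M N P : manifoldType R} (f : M -> N) (g : M -> P) x :
  smooth_at f x -> smooth_at g x -> smooth_at (fun y => (f y, g y)) x.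
Proof.
move=> fx gx; have [c Mc cx] := atlas_cover x.
have [d Nd dx] := atlas_cover (f x); have [e Pe ex] := atlas_cover (g x).
have [Q [oO Ox Osub CO]] := smooth_at_charts fx Mc Nd cx dx.
have [Q' [oO' Ox' Osub' CO']] := smooth_at_charts gx Mc Pe cx ex.
have oOO' := openI oO oO'.
exists c, (prod_chart d e); split=> //; first by exists d => //; exists e.
exists (Q `&` Q'); split=> //.
- by move=> v [/Osub[cv dv] /Osub'[_ ev]].
- apply: Cinfty_row_mx => //; first by apply: Cinfty_sub CO => v [].
  by apply: Cinfty_sub CO' => v [].
Qed.

Lemma smooth_at_rV {m n : nat} (U : set 'rV[R]_m) (f : 'rV[R]_m -> 'rV[R]_n) x :
  open U -> Cinfty U f -> U x -> smooth_at f x.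
Proof. by move=> oU Cf Ux; exists rV_chart, rV_chart; split=> //; exists U. Qed.

End SmoothMaps.

HB.mixin Record isLieGroup (R : realType) G of Manifold R G & Group G := {
  mulg_smooth : smooth (fun p : G * G => (p.1 * p.2)%g);
  invg_smooth : smooth (fun x : G => x^-1%g)
}.

#[short(type="lieGroupType")]
HB.structure Definition LieGroup (R : realType) :=
  {G of Manifold R G & Group G & isLieGroup R G}.

Section Diff.
Context {R : realType} {M : manifoldType R}.

Definition is_diffeo (f : M -> M) : Prop :=
  smooth f /\ exists g, [/\ cancel f g, cancel g f & smooth g].

(* Diff(M), a group for composition. *)
Record diff_group := DiffGroup {
  diff_fun :> M -> M;
  diff_is_diffeo : is_diffeo diff_fun
}.

Lemma diff_eqP (f g : diff_group) : diff_fun f =1 diff_fun g -> f = g.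
Proof.
case: f g => [f Pf] [g Pg] /= /funext fg; rewrite -{g}fg in Pg *.
by congr DiffGroup; exact: Prop_irrelevance.
Qed.

HB.instance Definition _ := gen_eqMixin diff_group.
HB.instance Definition _ := gen_choiceMixin diff_group.

Lemma id_diffeo : is_diffeo id.
Proof. by split; [exact: smooth_at_id|exists id; split=> // x; exact: smooth_at_id]. Qed.

Lemma comp_diffeo (f g : diff_group) : is_diffeo (f \o g).
Proof.
case: f g => [f [sf [f' [fK f'K sf']]]] [g [sg [g' [gK g'K sg']]]] /=.
split; first by move=> x; exact: smooth_at_comp.
exists (g' \o f'); split; [exact: can_comp|exact: can_comp|].
by move=> x; exact: smooth_at_comp.
Qed.

Definition diff_invfun (f : diff_group) : {g : M -> M |
  [/\ cancel f g, cancel g f & smooth g]} := cid (diff_is_diffeo f).2.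

Lemma inv_diffeo (f : diff_group) : is_diffeo (sval (diff_invfun f)).
Proof.
have [fK gK sg] := svalP (diff_invfun f).
by split=> //; exists f; split=> //; exact: (diff_is_diffeo f).1.
Qed.

Definition diff_one := DiffGroup id_diffeo.
Definition diff_mul f g := DiffGroup (comp_diffeo f g).
Definition diff_inv f := DiffGroup (inv_diffeo f).

Lemma diff_mulA : associative diff_mul.
Proof. by move=> f g h; exact: diff_eqP. Qed.
Lemma diff_mul1 : left_id diff_one diff_mul.
Proof. by move=> f; exact: diff_eqP. Qed.
Lemma diff_mul1r : right_id diff_one diff_mul.
Proof. by move=> f; exact: diff_eqP. Qed.
Lemma diff_mulV : left_inverse diff_one diff_inv diff_mul.
Proof.
by move=> f; apply: diff_eqP => x /=; have [fK _ _] := svalP (diff_invfun f).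
Qed.
Lemma diff_mulVr : right_inverse diff_one diff_inv diff_mul.
Proof.
by move=> f; apply: diff_eqP => x /=; have [_ gK _] := svalP (diff_invfun f).
Qed.

HB.instance Definition _ := isGroup.Build diff_group
  diff_mulA diff_mul1 diff_mul1r diff_mulV diff_mulVr.
End Diff.
Arguments diff_group {R} M.

(* A parametrization is a pair of an open set U of R^n and a total function on
   R^n, of which only the restriction to U matters (plot_ext). *)
Record diffeology (R : realType) (X : Type) := Diffeology {
  plot : forall n, set 'rV[R]_n -> ('rV[R]_n -> X) -> Prop;
  plot_open : forall n (U : set 'rV[R]_n) f, plot U f -> open U;
  plot_ext : forall n (U : set 'rV[R]_n) f g,
    (forall r, U r -> f r = g r) -> plot U f -> plot U g;
  plot_cst : forall n (U : set 'rV[R]_n) x, open U -> plot U (fun=> x);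
  plot_local : forall n (U : set 'rV[R]_n) f, open U ->
    (forall r, U r -> exists V, [/\ open V, V r, V `<=` U & plot V f]) ->
    plot U f;
  plot_comp : forall n p (U : set 'rV[R]_n) (V : set 'rV[R]_p) f h,
    plot U f -> open V -> Cinfty V h -> (forall r, V r -> U (h r)) ->
    plot V (f \o h)
}.

Definition dsmooth {R : realType} {X Y : Type} (DX : diffeology R X)
    (DY : diffeology R Y) (f : X -> Y) : Prop :=
  forall n (U : set 'rV[R]_n) p, plot DX U p -> plot DY U (f \o p).

Definition diffeomorphism {R : realType} {X Y : Type} (DX : diffeology R X)
    (DY : diffeology R Y) (f : X -> Y) : Prop :=
  dsmooth DX DY f /\
  exists g, [/\ cancel f g, cancel g f & dsmooth DY DX g].

Section SubsetDiffeology.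
Context {R : realType} {X : Type} (D : diffeology R X) (A : set X).

Definition subset_plot n (U : set 'rV[R]_n) (p : 'rV[R]_n -> A) :=
  plot D U (set_val \o p).

Lemma subset_plot_open n (U : set 'rV[R]_n) p : subset_plot U p -> open U.
Proof. exact: plot_open. Qed.

Lemma subset_plot_ext n (U : set 'rV[R]_n) (f g : 'rV[R]_n -> A) :
  (forall r, U r -> f r = g r) -> subset_plot U f -> subset_plot U g.
Proof. by move=> fg; apply: plot_ext => r /fg /= ->. Qed.

Lemma subset_plot_cst n (U : set 'rV[R]_n) x : open U -> subset_plot U (fun=> x).
Proof. exact: plot_cst. Qed.

Lemma subset_plot_local n (U : set 'rV[R]_n) f : open U ->
  (forall r, U r -> exists V, [/\ open V, V r, V `<=` U & subset_plot V f]) ->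
  subset_plot U f.
Proof. exact: plot_local. Qed.

Lemma subset_plot_comp n p (U : set 'rV[R]_n) (V : set 'rV[R]_p) f h :
  subset_plot U f -> open V -> Cinfty V h -> (forall r, V r -> U (h r)) ->
  subset_plot V (f \o h).
Proof. exact: plot_comp. Qed.

Definition subset_diffeology : diffeology R A :=
  Diffeology subset_plot_open subset_plot_ext subset_plot_cst subset_plot_local subset_plot_comp.
End SubsetDiffeology.

Section ManifoldDiffeology.
Context {R : realType} (M : manifoldType R).

Definition manifold_plot n (U : set 'rV[R]_n) (p : 'rV[R]_n -> M) :=
  open U /\ forall r, U r -> smooth_at p r.

Lemma manifold_plot_open n (U : set 'rV[R]_n) p : manifold_plot U p -> open U.
Proof. by case. Qed.

Lemma manifold_plot_ext n (U : set 'rV[R]_n) (f g : 'rV[R]_n -> M) :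
  (forall r, U r -> f r = g r) -> manifold_plot U f -> manifold_plot U g.
Proof.
move=> fg [oU fU]; split=> // r Ur; apply: smooth_at_near (fU r Ur).
by apply: filterS (open_nbhs_nbhs (conj oU Ur)).
Qed.

Lemma manifold_plot_cst n (U : set 'rV[R]_n) x : open U -> manifold_plot U (fun=> x).
Proof. by move=> oU; split=> // r _; exact: smooth_at_cst. Qed.

Lemma manifold_plot_local n (U : set 'rV[R]_n) f : open U ->
  (forall r, U r -> exists V, [/\ open V, V r, V `<=` U & manifold_plot V f]) ->
  manifold_plot U f.
Proof. by move=> oU loc; split=> // r /loc[V [_ Vr _ [_]]]; exact. Qed.

Lemma manifold_plot_comp n p (U : set 'rV[R]_n) (V : set 'rV[R]_p) f h :
  manifold_plot U f -> open V -> Cinfty V h -> (forall r, V r -> U (h r)) ->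
  manifold_plot V (f \o h).
Proof.
move=> [oU fU] oV Ch hU; split=> // r Vr.
by apply: smooth_at_comp; [exact: (smooth_at_rV oV Ch)|exact/fU/hU].
Qed.

Definition manifold_diffeology : diffeology R M :=
  Diffeology manifold_plot_open manifold_plot_ext manifold_plot_cst manifold_plot_local manifold_plot_comp.
End ManifoldDiffeology.

Section FunctionalDiffeology.
Context {R : realType} (M : manifoldType R).

(* (r, m) |-> p r m is smooth on the open subset U `*` setT of R^n x M. *)
Definition functional_plot n (U : set 'rV[R]_n)
    (p : 'rV[R]_n -> diff_group M) :=
  open U /\ forall r m, U r ->
    smooth_at (fun q : 'rV[R]_n * M => p q.1 q.2) (r, m).

Lemma functional_plot_open n (U : set 'rV[R]_n) p : functional_plot U p -> open U.
Proof. by case. Qed.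

Lemma functional_plot_ext n (U : set 'rV[R]_n) (f g : 'rV[R]_n -> diff_group M) :
  (forall r, U r -> f r = g r) -> functional_plot U f -> functional_plot U g.
Proof.
move=> fg [oU fU]; split=> // r m Ur; apply: smooth_at_near (fU r m Ur).
exists (U, setT); first by split; [exact: open_nbhs_nbhs|exact: filterT].
by move=> q [/= /fg ->].
Qed.

Lemma functional_plot_cst n (U : set 'rV[R]_n) x : open U -> functional_plot U (fun=> x).
Proof.
move=> oU; split=> // r m _.
apply: (@smooth_at_comp _ _ _ _ snd x); first exact: smooth_at_snd.
exact: (diff_is_diffeo x).1.
Qed.

Lemma functional_plot_local n (U : set 'rV[R]_n) f : open U ->
  (forall r, U r -> exists V, [/\ open V, V r, V `<=` U & functional_plot V f]) ->
  functional_plot U f.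
Proof. by move=> oU loc; split=> // r m /loc[V [_ Vr _ [_]]]; exact. Qed.

Lemma functional_plot_comp n p (U : set 'rV[R]_n) (V : set 'rV[R]_p) f h :
  functional_plot U f -> open V -> Cinfty V h -> (forall r, V r -> U (h r)) ->
  functional_plot V (f \o h).
Proof.
move=> [oU fU] oV Ch hU; split=> // r m Vr.
apply: (@smooth_at_comp _ _ _ _ (fun q : 'rV[R]_p * M => (h q.1, q.2))
  (fun q : 'rV[R]_n * M => f q.1 q.2)); last exact/fU/hU.
apply: smooth_at_pair; last exact: smooth_at_snd.
apply: (@smooth_at_comp _ _ _ _ fst h); first exact: smooth_at_fst.
exact: (smooth_at_rV oV Ch).
Qed.

Definition functional_diffeology : diffeology R (diff_group M) :=
  Diffeology functional_plot_open functional_plot_ext functional_plot_cst functional_plot_local functional_plot_comp.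
End FunctionalDiffeology.

Definition smooth_action {R : realType} {G : lieGroupType R}
    {M : manifoldType R} (rho : G -> diff_group M) : Prop :=
  {morph rho : g h / (g * h)%g >-> (g * h)%g} /\
  dsmooth (manifold_diffeology G) (functional_diffeology M) rho.

Definition dtop {R : realType} {X : choiceType} (D : diffeology R X) : Type := X.

Section DTopology.
Context {R : realType} {X : choiceType} (D : diffeology R X).

HB.instance Definition _ := Choice.on (dtop D).

Definition dopen (A : set (dtop D)) : Prop :=
  forall n (U : set 'rV[R]_n) p, plot D U p -> open (U `&` p @^-1` A).

Lemma dopenT : dopen setT.
Proof. by move=> n U p /plot_open; rewrite preimage_setT setIT. Qed.

Lemma dopenI (A B : set (dtop D)) : dopen A -> dopen B -> dopen (A `&` B).
Proof.
move=> oA oB n U p pU; rewrite preimage_setI setIIr.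
by apply: openI; [exact: oA|exact: oB].
Qed.

Lemma dopen_bigcup (I : Type) (F : I -> set (dtop D)) :
  (forall i, dopen (F i)) -> dopen (\bigcup_i F i).
Proof.
move=> oF n U p pU; rewrite preimage_bigcup setI_bigcupr.
by apply: bigcup_open => i _; exact: oF.
Qed.

HB.instance Definition _ := isOpenTopological.Build (dtop D)
  dopenT dopenI dopen_bigcup.
End DTopology.

Definition homeomorphism {S T : topologicalType} (f : S -> T) : Prop :=
  continuous f /\ exists g, [/\ cancel f g, cancel g f & continuous g].

Definition to_range {X Y : Type} (f : X -> Y) (x : X) : range f :=
  SigSub (mem_set (imageT f x)).

Definition is_induction {R : realType} {X Y : Type} (DX : diffeology R X)
    (DY : diffeology R Y) (f : X -> Y) : Prop :=
  [/\ injective f, dsmooth DX DY f &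
    diffeomorphism DX (subset_diffeology DY (range f)) (to_range f)].

Definition is_embedding {R : realType} {X Y : choiceType} (DX : diffeology R X)
    (DY : diffeology R Y) (f : X -> Y) : Prop :=
  is_induction DX DY f /\
  @homeomorphism (dtop DX) (set_type (range f : set (dtop DY))) (to_range f).

(* Main.v *)
Require Import Defs.
From HB Require Import structures.
From mathcomp Require Import all_boot all_order all_algebra.
From mathcomp Require Import all_classical all_reals all_analysis.

(** Evaluation at the points of [mu] is a smooth map [f |-> (f (mu i))_i] from
    Diff(M), with its functional diffeology, to M^k, and the orbit map of [mu]
    is its composite with [rho].  So the theorem is an instance of a general
    cancellation property ([embedding_factor]): in diffeological spaces, if
    [e \o f] is an embedding and [e] and [f] are smooth, then [f] is an
    embedding.  Indeed, the inverse of [f] on its image is the restriction of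
    [e] followed by the inverse of [e \o f] on its image; the restriction of
    [e] is smooth for the subset diffeologies because [e] is smooth, and
    continuous for the subset topologies because smooth maps are continuous
    for the D-topologies.

    What is left is the smoothness of the evaluation ([evaluation_smooth]): a
    map into M^k is smooth as soon as its components are
    ([smooth_at_power]), and evaluation at one point is smooth by the very
    definition of the functional diffeology. *)

Set Implicit Arguments.
Unset Strict Implicit.
Unset Printing Implicit Defensive.

Import numFieldNormedType.Exports.

Local Open Scope classical_set_scope.
Local Open Scope ring_scope.

Lemma dsmooth_continuous {R : realType} {X Y : choiceType}
    (DX : diffeology R X) (DY : diffeology R Y) (f : X -> Y) :
  dsmooth DX DY f -> continuous (f : dtop DX -> dtop DY).
Proof.
move=> sf; apply/continuousP => A oA.
have oA' : @dopen _ _ DY A := oA.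
suff : @dopen _ _ DX (f @^-1` A) by [].
by move=> n U p /sf; exact: oA'.
Qed.

Section Factor.
Context {R : realType} {X Y Z : choiceType}.
Context (DX : diffeology R X) (DY : diffeology R Y) (DZ : diffeology R Z).

Lemma range_comp_sub (f : X -> Y) (e : Y -> Z) (y : range f) :
  range (e \o f) (e (val y)).
Proof. by case: y => y /= /set_mem[x _ <-]; exists x. Qed.

Definition range_factor (f : X -> Y) (e : Y -> Z) (y : range f) :
    range (e \o f) :=
  SigSub (mem_set (range_comp_sub e y)).

Lemma range_factor_to_range (f : X -> Y) (e : Y -> Z) (x : X) :
  range_factor e (to_range f x) = to_range (e \o f) x.
Proof. exact: val_inj. Qed.

(** Every point of the image of [f] has the form [to_range f x], so that a left
    inverse of the surjection [to_range f] is also a right inverse. *)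
Lemma range_factor_inverse (f : X -> Y) (e : Y -> Z) (g : range (e \o f) -> X) :
  cancel (to_range (e \o f)) g ->
  cancel (to_range f) (g \o range_factor e) /\
  cancel (g \o range_factor e) (to_range f).
Proof.
move=> gK; have K : cancel (to_range f) (g \o range_factor e).
  by move=> x /=; rewrite range_factor_to_range gK.
split=> // y; have [x _ xy] := set_mem (valP y).
have <- : to_range f x = y by exact: val_inj.
by rewrite K.
Qed.

(** The inverse of [f] on its image is obtained from the inverse of [e \o f] on
    its image by composition with the restriction of [e]; this is used twice,
    for the smooth inverse [g] and for the continuous inverse [h]. *)
Lemma embedding_factor (f : X -> Y) (e : Y -> Z) :
  dsmooth DX DY f -> dsmooth DY DZ e ->
  is_embedding DX DZ (e \o f) -> is_embedding DX DY f.
Proof.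
move=> sf se [[inj_ef _ [_ [g [gK _ sg]]]] [_ [h [hK _ ch]]]].
split; first split=> //.
- by move=> x y fxy; apply: inj_ef; rewrite /= fxy.
- split; first by move=> n U p pU; exact: sf.
  have [fK Kf] := range_factor_inverse gK.
  exists (g \o range_factor e); split=> // n U p pU.
  apply: (sg n U (range_factor e \o p)); exact: (se n U _ pU).
- split; first by apply: (@continuous_comp_initial
    (set_type (range (f : X -> dtop DY))) (dtop DX) (dtop DY) set_val);
    exact: dsmooth_continuous.
  have [fK Kf] := range_factor_inverse hK.
  exists (h \o range_factor e); split=> //.
  have cv : continuous (set_val : set_type (range (f : X -> dtop DY)) -> dtop DY).
    exact: initial_continuous.
  have ce : continuous (range_factor e : set_type (range (f : X -> dtop DY)) ->
      set_type (range (e \o f : X -> dtop DZ))).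
    apply: (@continuous_comp_initial (set_type (range (e \o f : X -> dtop DZ))) _
      (dtop DZ) set_val).
    move=> y; apply: (@continuous_comp _ (dtop DY) (dtop DZ) set_val e).
      exact: cv.
    exact: dsmooth_continuous.
  by move=> y; apply: continuous_comp; [exact: ce|exact: ch].
Qed.
End Factor.

Section Evaluation.
Context {R : realType}.

(** A power chart around [f x] is a family of charts [d i] of M around the
    [f x i], and read in it the coordinates of [f] are those of its
    components.  These are finitely many, so that the neighbourhoods [Q i] on
    which they are smooth have an open intersection. *)
Lemma smooth_at_power {M N : manifoldType R} {k : nat} (f : N -> power M k)
    (x : N) :
  (forall i, smooth_at (fun y => f y i) x) -> smooth_at f x.
Proof.
move=> fx; have [c Nc cx] := atlas_cover x.
have /choice[d dP] i : exists d, atlas M d /\ cdom d (f x i).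
  by have [d Md dfx] := atlas_cover (f x i); exists d.
have /choice[Q QP] i := smooth_at_charts (fx i) Nc (dP i).1 cx (dP i).2.
(* The first condition keeps [Q'] inside [cimg c] also when [k = 0]. *)
pose Q' := [set v | cimg c v /\ forall i, Q i v].
have oQ' : open Q'.
  rewrite openE => v [cv Qv]; apply: filterI.
    by apply: open_nbhs_nbhs; split=> //; exact: cimg_open.
  apply: (@filter_forall _ _ (fun i => Q i) (nbhs v) (nbhs_filter v)) => i.
  by apply: open_nbhs_nbhs; split=> //; have [] := QP i.
exists c, (power_chart d); split=> //.
  by exists d => // i; have [] := dP i.
exists Q'; split=> //.
- by split; [exact: cmap_img|move=> i; have [] := QP i].
- move=> v [cv Qv]; split=> // i.
  by have [_ _ /(_ v (Qv i))[]] := QP i.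
- move=> l; apply/Ck_coordP => // b; case/mxvec_indexP: b => i j.
  have -> : (fun v => (cmap (power_chart d) \o f \o cinv c) v ord0
      (mxvec_index i j)) =
    (fun v => (cmap (d i) \o (fun y => f y i) \o cinv c) v ord0 j).
    by apply/funext => v /=; rewrite mxvecE mxE.
  have CQ : Cinfty Q' (cmap (d i) \o (fun y => f y i) \o cinv c).
    by have [_ _ _] := QP i; apply: Cinfty_sub => v [_].
  by have /(Ck_coordP _ _ oQ') := CQ l; apply.
Qed.

(** Along a plot [p], the [i]-th component is [r |-> p r (mu i)]: the smooth map
    [(r, m) |-> p r m] after the smooth map [r |-> (r, mu i)]. *)
Lemma evaluation_smooth {M : manifoldType R} {k : nat} (mu : power M k) :
  dsmooth (functional_diffeology M) (manifold_diffeology (power M k))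
    (fun (f : diff_group M) i => f (mu i)).
Proof.
move=> n U p [oU sp]; split=> // r Ur; apply: smooth_at_power => i.
apply: (@smooth_at_comp _ _ _ _ (fun s : 'rV[R]_n => (s, mu i))
  (fun q : 'rV[R]_n * M => p q.1 q.2)); last exact: sp.
by apply: smooth_at_pair; [exact: smooth_at_id|exact: smooth_at_cst].
Qed.

End Evaluation.

Theorem mainTheorem2 (R : realType) (M : manifoldType R) (G : lieGroupType R)
    (rho : G -> diff_group M) (rho_action : smooth_action rho)
    (rho_effective : injective rho) (k : nat) (mu : power M k)
    (orbit_embedding : is_embedding (manifold_diffeology G)
       (manifold_diffeology (power M k))
       (fun (g : G) (i : 'I_k) => rho g (mu i))) :
  is_embedding (manifold_diffeology G) (functional_diffeology M) rho.
Proof.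
apply: (embedding_factor _ (evaluation_smooth mu)) orbit_embedding.
by case: rho_action.
Qed.
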